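(* The Fréchet algebra topologies $\tau_{\partial_i}$, $i\in\mathbb{Z}^+$, are mutually equivalent on the algebra $\mathcal{F}_\infty\oplus\mathcal{F}_\infty$.
   Context: $\mathbb{Z}^+=\{1,2,\ldots\}$. $\mathcal{F}_\infty=\mathbb{C}[[X_0,X_1,\ldots]]$ is the algebra of all formal power series in the commuting indeterminates $X_0,X_1,\ldots$, and $\partial_i=\partial/\partial X_i$ is the usual partial derivative on it. A Fréchet algebra topology is a complete metrizable locally convex topology generated by an increasing sequence of submultiplicative seminorms; two such topologies are equivalent if they coincide. $\tau_c$ is the Fréchet algebra topology on $\mathcal{F}_\infty$ of coefficientwise convergence; fix an increasing sequence $(p_k)_k$ of submultiplicative seminorms generating $\tau_c$. $\mathcal{F}_\infty\oplus\mathcal{F}_\infty$ is the vector space direct sum with product $(x,m)(y,n)=(xy,xn+ym)$, and $\tau_{\partial_i}$ is the Fréchet algebra topology on it generated by the seminorms $q_{k,\partial_i}(x,m)=p_k(x)+p_k(\partial_i(x)-m)$. *)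

(* Defs.v *)
From HB Require Import structures.
From mathcomp Require Import all_boot all_order all_algebra finmap.
From mathcomp Require Import all_classical all_reals all_analysis.
From mathcomp Require Import complex.
(* The notations of multinomials clash with those of analysis. *)
From mathcomp Require monalg.
Import -(notations) monalg.

Set Implicit Arguments.
Unset Strict Implicit.
Unset Printing Implicit Defensive.

Import GRing.Theory Num.Theory Order.TTheory numFieldNormedType.Exports.
Local Open Scope classical_set_scope.
Local Open Scope ring_scope.

Section Monomials.
Implicit Types m a b : cmonom nat.

Lemma cmonomP m1 m2 : (forall i, m1 i = m2 i) <-> m1 = m2.
Proof. by split=> [h|-> //]; apply/eqP/cmP => i; rewrite h. Qed.

Lemma mmulI a : injective (mmul a).
Proof.
move=> b c /cmonomP h; apply/cmonomP => i; have := h i.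
by rewrite !cmM => /addnI.
Qed.

Lemma finite_factorizations m : finite_set [set ab | mmul ab.1 ab.2 = m].
Proof.
pose D m := [set a | exists b, mmul a b = m].
have fD n m' : mdeg m' = n -> finite_set (D m').
  elim: n m' => [|n IH] m' degm.
    move/mdeg_eq0I: degm => ->.
    apply: (@sub_finite_set _ _ [set mone]); last exact: finite_set1.
    by move=> a [b /unitm[->]].
  have [i mi] : exists i, m' i != 0%N.
    apply: contrapT => /forallNP h.
    suff m1 : m' = mone by rewrite m1 mdeg1 in degm.
    by apply/cmonomP => i; rewrite cm1; have /negP/negPn/eqP := h i.
  pose q a := divcm a (ucm i).
  have qK a : a i != 0%N -> mmul (ucm i) (q a) = a.
    move=> ai; apply/cmonomP => j; rewrite cmM cmU divcmE cmU.
    by case: eqVneq => [<-|_] /=; [rewrite subnKC// lt0n|rewrite subn0].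
  have degq : mdeg (q m') = n.
    by have := congr1 mdeg (qK _ mi); rewrite mdegM mdegU degm => -[].
  apply: (@sub_finite_set _ _ (D (q m') `|` mmul (ucm i) @` D (q m'))).
    move=> a [b abm].
    have [ai|ai] := eqVneq (a i) 0%N; last first.
      right; exists (q a); last exact: qK.
      by exists b; apply: (@mmulI (ucm i)); rewrite mulmA !qK.
    have bi : b i != 0%N by move: mi; rewrite -abm cmM ai.
    left; exists (q b); apply: (@mmulI (ucm i)).
    by rewrite mulmA (mulmC (ucm i)) -mulmA !qK.
  by rewrite finite_setU; split; [|apply: finite_image]; exact: IH.
apply: (@sub_finite_set _ _ (D m `*` D m)).
  move=> [a b] /= abm; split => /=; first by exists b.
  by exists a; rewrite mulmC.
by apply: finite_setX; exact: (fD (mdeg m)).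
Qed.

End Monomials.

(* K[[X_0, X_1, ...]], a series being the family of its coefficients indexed
   by the finitely supported exponents [cmonom nat], with no restriction on the
   number of variables that occur.  The multiplication below is the Cauchy
   product, not the pointwise one of [T -> K]. *)
Definition fps (K : comNzRingType) : Type := cmonom nat -> K^o.

HB.instance Definition _ (K : comNzRingType) :=
  GRing.Lmodule.copy (fps K) (cmonom nat -> K^o).

Section PowerSeriesAlgebra.
Variable K : comNzRingType.
Implicit Types (x y z : fps K) (m : cmonom nat).

Definition fps_one : fps K := fun m => (m == mone)%:R.

(* The index set is finite, see [finite_factorizations]. *)
Definition fps_mul x y : fps K := fun m =>
  \sum_(ab \in [set ab | mmul ab.1 ab.2 = m]) (x ab.1 * y ab.2 : K).

Definition factors m : {fset cmonom nat} :=
  fset_set (fst @` [set ab | mmul ab.1 ab.2 = m]).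

Lemma factorsP m a : reflect (exists b, mmul a b = m) (a \in factors m).
Proof.
rewrite in_fset_set; last by apply: finite_image; exact: finite_factorizations.
apply: (iffP idP) => [/set_mem[[c b] /= cb <-]|[b ab]]; first by exists b.
by apply/mem_set; exists (a, b).
Qed.

Lemma fps_mulE (S : {fset cmonom nat}) x y m :
    (forall a, a \in factors m -> a \in S) ->
  fps_mul x y m = \sum_(a <- S) \sum_(b <- S | mmul a b == m) x a * y b.
Proof.
move=> mS; rewrite pair_big_dep_cond /= /fps_mul.
rewrite fsbig_finite/=; last exact: finite_factorizations.
apply: eq_fbigl => -[a b]; rewrite in_fset_set; last exact: finite_factorizations.
apply/idP/imfset2P => [/set_mem /= ab|].
  have aS : a \in S by apply: mS; apply/factorsP; exists b.
  have bS : b \in S by apply: mS; apply/factorsP; exists a; rewrite mulmC.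
  exists a; first by rewrite in_fset inE /= aS.
  by exists b => //; rewrite in_fset inE /= bS ab eqxx.
move=> [a' _ [b' + [-> ->]]]; rewrite in_fset inE /= => /andP[_ /eqP ab].
exact: ab.
Qed.

Lemma fps_mulC : commutative fps_mul.
Proof.
move=> x y; apply/funext => m; rewrite !(@fps_mulE (factors m))//.
rewrite (exchange_big_dep xpredT)//=; apply: eq_bigr => a _.
by apply: eq_big => [b|b _]; rewrite 1?mulmC 1?mulrC.
Qed.

Lemma fps_mul1 : left_id fps_one fps_mul.
Proof.
move=> x; apply/funext => m; rewrite (@fps_mulE (factors m))//.
have m1 : mone \in factors m by apply/factorsP; exists m; rewrite mul1m.
have mm : m \in factors m by apply/factorsP; exists mone; rewrite mulm1.
rewrite (big_fsetD1 mone m1) /= [X in _ + X]big1_fset.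
  rewrite addr0 big_mkcond (big_fsetD1 m mm) /= mul1m eqxx.
  rewrite {1}/fps_one eqxx mul1r big1_fset ?addr0// => b.
  by rewrite in_fsetD1 mul1m => /andP[/negPf -> _].
move=> a; rewrite in_fsetD1 => /andP[/negPf a1 _] _.
by apply: big1 => b _; rewrite /fps_one a1 mul0r.
Qed.

Lemma fps_mulDl : left_distributive fps_mul +%R.
Proof.
move=> x y z; apply/funext => m.
rewrite [RHS]/GRing.add/= !(@fps_mulE (factors m))// -big_split /=.
apply: eq_bigr => a _; rewrite -big_split /=; apply: eq_bigr => b _.
exact: mulrDl.
Qed.

Lemma fps_mulAl (k : K) x y : k *: fps_mul x y = fps_mul (k *: x) y.
Proof.
apply/funext => m; rewrite [LHS]/GRing.scale/= !(@fps_mulE (factors m))//.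
rewrite [LHS]mulr_sumr; apply: eq_bigr => a _; rewrite mulr_sumr.
by apply: eq_bigr => b _; rewrite mulrA.
Qed.

Lemma fps_mulA : associative fps_mul.
Proof.
have key x y z m : fps_mul x (fps_mul y z) m =
    \sum_(a <- factors m) \sum_(b <- factors m) \sum_(c <- factors m |
      mmul a (mmul b c) == m) x a * (y b * z c).
  rewrite (@fps_mulE (factors m))//; apply: eq_bigr => a _.
  transitivity (\sum_(n <- factors m | mmul a n == m) \sum_(b <- factors m)
     \sum_(c <- factors m | mmul b c == n) x a * (y b * z c)).
    apply: eq_bigr => n /eqP anm; rewrite (@fps_mulE (factors m)).
      by rewrite mulr_sumr; apply: eq_bigr => b _; rewrite mulr_sumr.
    move=> b /factorsP[c bcn]; apply/factorsP; exists (mmul a c).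
    by rewrite -anm -bcn mulmA (mulmC b) mulmA.
  rewrite exchange_big /=; apply: eq_bigr => b _.
  rewrite (exchange_big_dep (fun c => mmul a (mmul b c) == m))/=; last first.
    by move=> n c /eqP <- /eqP ->.
  apply: eq_bigr => c /eqP abcm; have bcm : mmul b c \in factors m.
    by apply/factorsP; exists a; rewrite mulmC.
  rewrite big_mkcond (big_fsetD1 _ bcm) /= abcm !eqxx /= big1_fset ?addr0// => n.
  by rewrite in_fsetD1 eq_sym => /andP[/negPf -> _] _; rewrite andbF.
move=> x y z; apply/funext => m; rewrite (fps_mulC (fps_mul x y)) !key.
rewrite [RHS]exchange_big /=; apply: eq_bigr => a _.
under [LHS]eq_bigr do rewrite big_mkcond; under [RHS]eq_bigr do rewrite big_mkcond.
rewrite [RHS]exchange_big /=; apply: eq_bigr => b _; apply: eq_bigr => c _.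
by rewrite (mulmC c) -mulmA mulrA (mulrC (z c)).
Qed.

Lemma fps_one_neq0 : fps_one != 0.
Proof.
apply/eqP => /(congr1 (fun x : fps K => x mone)); rewrite /fps_one eqxx.
by move/eqP; rewrite oner_eq0.
Qed.

HB.instance Definition _ := GRing.Zmodule_isComNzRing.Build (fps K)
  fps_mulA fps_mulC fps_mul1 fps_mulDl fps_one_neq0.
HB.instance Definition _ := GRing.Lmodule_isLalgebra.Build K (fps K) fps_mulAl.
HB.instance Definition _ := GRing.Lalgebra_isComAlgebra.Build K (fps K).

(* The coefficient of X^m in dx/dX_i is (m_i + 1) times that of X_i * X^m
   in x. *)
Definition fps_deriv (i : nat) (x : fps K) : fps K :=
  fun m => x (mmul (ucm i) m) *+ (m i).+1.

End PowerSeriesAlgebra.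

(* A (+) A with (x, m)(y, n) = (xy, xn + ym); the plain [A * A] carries the
   componentwise product instead. *)
Definition triv_ext (K : comNzRingType) (A : comAlgType K) : Type :=
  (A * A)%type.

HB.instance Definition _ (K : comNzRingType) (A : comAlgType K) :=
  GRing.Lmodule.copy (triv_ext A) (A * A)%type.

Section TrivialExtension.
Variables (K : comNzRingType) (A : comAlgType K).

Definition triv_ext_one : triv_ext A := (1, 0).

Definition triv_ext_mul (u v : triv_ext A) : triv_ext A :=
  (u.1 * v.1, u.1 * v.2 + v.1 * u.2).

Lemma triv_ext_mulA : associative triv_ext_mul.
Proof.
move=> [x m] [y n] [z k]; congr pair => /=; first exact: mulrA.
by rewrite !mulrDr !mulrA -addrA (mulrC z) (mulrC z y) (mulrC x z).
Qed.

Lemma triv_ext_mulC : commutative triv_ext_mul.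
Proof.
by move=> [x m] [y n]; congr pair => /=; [rewrite mulrC|rewrite addrC].
Qed.

Lemma triv_ext_mul1 : left_id triv_ext_one triv_ext_mul.
Proof. by move=> [x m]; congr pair => /=; rewrite !mul1r// mulr0 addr0. Qed.

Lemma triv_ext_mulDl : left_distributive triv_ext_mul +%R.
Proof.
move=> [x m] [y n] [z k]; congr pair => /=; first exact: mulrDl.
by rewrite mulrDl mulrDr addrACA.
Qed.

Lemma triv_ext_one_neq0 : triv_ext_one != 0.
Proof. by apply/eqP => -[/eqP]; rewrite oner_eq0. Qed.

Lemma triv_ext_mulAl (k : K) (u v : triv_ext A) :
  k *: triv_ext_mul u v = triv_ext_mul (k *: u) v.
Proof.
case: u v => [x m] [y n]; congr pair => /=; first by rewrite scalerAl.
by rewrite scalerDr scalerAl scalerAr.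
Qed.

HB.instance Definition _ := GRing.Zmodule_isComNzRing.Build (triv_ext A)
  triv_ext_mulA triv_ext_mulC triv_ext_mul1 triv_ext_mulDl triv_ext_one_neq0.
HB.instance Definition _ :=
  GRing.Lmodule_isLalgebra.Build K (triv_ext A) triv_ext_mulAl.
HB.instance Definition _ := GRing.Lalgebra_isComAlgebra.Build K (triv_ext A).

End TrivialExtension.

(* A topology on a fixed algebra is given by its set of open sets, so that
   equivalence of topologies is equality. *)
Section FrechetAlgebraTopology.
Variables (R : realType) (A : algType R[i]).
Implicit Types (p : nat -> A -> R) (d : A -> A -> R) (tau : set (set A)).

Definition submultiplicative_seminorm (p : A -> R) : Prop :=
  [/\ forall x, 0 <= p x,
      forall x y, p (x + y) <= p x + p y,
      forall (c : R[i]) x, p (c *: x) = Normc.normc c * p x &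
      forall x y, p (x * y) <= p x * p y].

Definition increasing_submultiplicative_seminorms p : Prop :=
  (forall k, submultiplicative_seminorm (p k)) /\
  (forall k x, p k x <= p k.+1 x).

Definition seminorm_topology p : set (set A) :=
  [set U | forall x, U x -> exists n (e : R), 0 < e /\
    [set y | forall k, (k <= n)%N -> p k (y - x) < e] `<=` U].

Definition metric_topology d : set (set A) :=
  [set U | forall x, U x -> exists2 e : R, 0 < e &
    [set y | d x y < e] `<=` U].

(* The metric is translation invariant, so that its Cauchy sequences are those
   of the topological vector space. *)
Definition complete_invariant_metric d : Prop :=
  [/\ forall x y, d x y = 0 <-> x = y,
      forall x y, d x y = d y x,
      forall x y z, d x z <= d x y + d y z,
      forall x y z, d (x + z) (y + z) = d x y &
      forall u : nat -> A,
        (forall e, 0 < e -> exists N, forall m n,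
           (N <= m)%N -> (N <= n)%N -> d (u m) (u n) < e) ->
        exists l, forall e, 0 < e -> exists N, forall n,
           (N <= n)%N -> d (u n) l < e].

(* Local convexity is part of being generated by seminorms. *)
Definition frechet_algebra_topology tau : Prop :=
  (exists d, complete_invariant_metric d /\ tau = metric_topology d) /\
  (exists p, increasing_submultiplicative_seminorms p /\
     tau = seminorm_topology p).

End FrechetAlgebraTopology.

Definition coefficientwise_topology (K : numFieldType) : set (set (fps K)) :=
  [set U | open (U : set {ptws cmonom nat -> K^o})].

Arguments coefficientwise_topology K : clear implicits.

Section DerivationTopology.
Variables (R : realType) (A : comAlgType R[i]).

Definition derivation_seminorm (D : A -> A) (p : nat -> A -> R) (k : nat)
    (u : triv_ext A) : R :=
  p k u.1 + p k (D u.1 - u.2).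

Definition derivation_topology (D : A -> A) (p : nat -> A -> R) :
    set (set (triv_ext A)) :=
  @seminorm_topology R (triv_ext A) (derivation_seminorm D p).

End DerivationTopology.

(* Main.v *)
Require Import Defs.
From mathcomp Require Import all_boot all_order all_algebra finmap.
From mathcomp Require Import all_classical all_reals all_analysis.
From mathcomp Require Import complex ring lra zify.
From mathcomp Require monalg.
Import -(notations) monalg.

(** On the power series algebra the derivation d_i is continuous for
    coefficientwise convergence: the coefficient of X^m in d_i x is a fixed
    multiple of one coefficient of x.  Hence (x_n, m_n) tends to 0 for
    q_{k,d_i} if and only if x_n and d_i x_n - m_n tend to 0, that is, if and
    only if x_n and m_n do, and this no longer mentions i: every topology is
    the product topology.  Formally, for two continuous derivations D1 and D2
    of an algebra topologized by seminorms p_k,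
      p_k (D1 x - m) <= p_k (D2 x - m) + p_k (D1 x) + p_k (D2 x),
    where the last two terms are small when x is ([derivation_topology_eq]).

    That each topology is a Frechet algebra topology holds for any derivation
    D of an algebra A whose topology is given by an increasing, separating and
    sequentially complete family of submultiplicative seminorms: the Leibniz
    rule makes q_{k,D} submultiplicative, and the bijection
    (x, m) |-> (x, D x - m) turns q_{k,D} into the sum of p_k on both
    components, so that separation and completeness pass from A to A (+) A.
    A complete invariant metric is then
      d x y = sup_k min (p_k (x - y), 1 / (k + 1)).

    What is specific to power series is that the p_k, about which nothing is
    known but the topology that they generate, separate points and are
    complete.  Both follow by comparing neighbourhoods of 0: a coefficient is
    controlled by some p_n ([coefficient_controlled]), and conversely
    convergence of every coefficient implies convergence for every p_k
    ([coefficientwise_cvg]). *)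

Set Implicit Arguments.
Unset Strict Implicit.
Unset Printing Implicit Defensive.

Import GRing.Theory Num.Theory Order.TTheory numFieldNormedType.Exports.
Local Open Scope classical_set_scope.
Local Open Scope ring_scope.

(** * Frechet topologies from seminorms *)

Section SeminormSequences.
Variables (R : realType) (A : algType R[i]).
Implicit Types (p : nat -> A -> R) (u : nat -> A).

Definition separating p : Prop := forall x, (forall k, p k x = 0) -> x = 0.

Definition seminorm_cauchy p u : Prop := forall k (e : R), 0 < e ->
  exists N, forall m n, (N <= m)%N -> (N <= n)%N -> p k (u m - u n) < e.

Definition seminorm_cvg p u (l : A) : Prop := forall k (e : R), 0 < e ->
  exists N, forall n, (N <= n)%N -> p k (u n - l) < e.

Definition sequentially_complete p : Prop :=
  forall u, seminorm_cauchy p u -> exists l, seminorm_cvg p u l.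

End SeminormSequences.

Section Seminorm.
Variables (R : realType) (A : algType R[i]) (q : A -> R).
Hypothesis qP : submultiplicative_seminorm q.

Lemma seminorm_ge0 x : 0 <= q x.
Proof. by case: qP. Qed.

Lemma seminormD x y : q (x + y) <= q x + q y.
Proof. by case: qP. Qed.

Lemma seminorm0 : q 0 = 0.
Proof. by case: qP => _ _ qZ _; rewrite -(scale0r 0) qZ Normc.normc0 mul0r. Qed.

Lemma seminormN x : q (- x) = q x.
Proof.
case: qP => _ _ qZ _; rewrite -scaleN1r qZ (@normcN _ (1 : Rcomplex R)).
by rewrite Normc.normc1 mul1r.
Qed.

Lemma seminorm_distC x y : q (x - y) = q (y - x).
Proof. by rewrite -seminormN opprB. Qed.

Lemma seminorm_dist_triangle x y z : q (x - z) <= q (x - y) + q (y - z).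
Proof.
have -> : x - z = (x - y) + (y - z) by rewrite addrA subrK.
exact: seminormD.
Qed.

End Seminorm.

Section IncreasingSeminorms.
Variables (R : realType) (A : algType R[i]) (p : nat -> A -> R).
Hypothesis pP : increasing_submultiplicative_seminorms p.

Lemma seminorm_leq k n x : (k <= n)%N -> p k x <= p n x.
Proof.
case: pP => _ pS; elim: n => [|n IH]; first by rewrite leqn0 => /eqP ->.
by rewrite leq_eqVlt => /predU1P[->//|/IH /le_trans]; apply.
Qed.

(** As the family increases, one seminorm gives a basic neighbourhood. *)
Lemma seminorm_topologyP U : seminorm_topology p U <->
  forall x, U x -> exists n (e : R), 0 < e /\ [set y | p n (y - x) < e] `<=` U.
Proof.
split=> h x /h[n [e [e0 sU]]]; exists n, e; split=> // y /= ye; apply: sU => /=.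
  by move=> k /seminorm_leq kn; apply: le_lt_trans ye.
exact: ye.
Qed.

Lemma seminorm_ball_open l k (e : R) :
  seminorm_topology p [set y | p k (y - l) < e].
Proof.
apply/seminorm_topologyP => x /= xe; exists k, (e - p k (x - l)).
split=> [|y /= yx]; first by rewrite subr_gt0.
have := seminorm_dist_triangle (pP.1 k) y x l; lra.
Qed.

(** A supremum rather than the usual series with weights 2^-k: a bound on it is
    then a bound on each term, and conversely. *)
Definition frechet_dist (x y : A) : R :=
  sup (range (fun k => Num.min (p k (x - y)) k.+1%:R^-1)).

Lemma frechet_dist_ge x y k :
  Num.min (p k (x - y)) k.+1%:R^-1 <= frechet_dist x y.
Proof.
apply: ub_le_sup; last by exists k.
by exists 1 => _ [n _ <-]; rewrite ge_min invf_le1 ?ler1n ?orbT ?ltr0n.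
Qed.

Lemma frechet_dist_le x y (e : R) :
  (forall k, Num.min (p k (x - y)) k.+1%:R^-1 <= e) -> frechet_dist x y <= e.
Proof.
move=> h; apply: ge_sup; last by move=> _ [k _ <-].
by exists (Num.min (p 0%N (x - y)) 1%:R^-1), 0%N.
Qed.

(** The truncation at 1 / (k + 1) is invisible below that level, so a small
    distance bounds the k-th seminorm. *)
Lemma frechet_dist_control k (e : R) : 0 < e ->
  exists2 d : R, 0 < d & forall x y, frechet_dist x y < d -> p k (x - y) < e.
Proof.
move=> e0; exists (Num.min e k.+1%:R^-1) => [|x y].
  by rewrite lt_min e0 invr_gt0 ltr0n.
move=> /(le_lt_trans (frechet_dist_ge x y k)).
by rewrite !lt_min !gt_min ltxx orbF => /andP[/orP[//|ke] /lt_trans]; apply.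
Qed.

(** All the terms of index above n are at most 1 / (n + 1), and the others are
    at most p_n. *)
Lemma frechet_dist_controlled (e : R) : 0 < e ->
  exists n (d : R), 0 < d /\
    forall x y, p n (x - y) < d -> frechet_dist x y < e.
Proof.
move=> e0; have e20 : 0 < e / 2 by rewrite divr_gt0.
have [n ne] : exists n : nat, n.+1%:R^-1 < e / 2.
  have [n nP] : exists n : nat, (e / 2)^-1 < n%:R.
    exists (Num.bound (e / 2)^-1); apply: archi_boundP.
    by rewrite invr_ge0 ltW.
  exists n; rewrite invf_plt ?posrE ?ltr0n//.
  by apply: lt_trans nP _; rewrite ltr_nat.
exists n, (e / 2); split=> // x y xy.
suff : frechet_dist x y <= e / 2 by lra.
apply: frechet_dist_le => k; rewrite ge_min; apply/orP.
have [kn|nk] := leqP k n.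
  by left; apply: le_trans (ltW xy); exact: seminorm_leq.
right; apply: le_trans (ltW ne).
by rewrite lef_pV2 ?posrE ?ltr0n// ler_nat; lia.
Qed.

Lemma frechet_topologyE :
  metric_topology frechet_dist = seminorm_topology p.
Proof.
apply/seteqP; split=> U hU.
  apply/seminorm_topologyP => x /hU[e e0 sU].
  have [n [d [d0 hd]]] := frechet_dist_controlled e0.
  exists n, d; split=> // y yx.
  by apply/sU/hd; rewrite (seminorm_distC (pP.1 n)).
move=> x Ux; have [n [e [e0 sU]]] := (seminorm_topologyP U).1 hU x Ux.
have [d d0 hd] := frechet_dist_control n e0; exists d => // y /= /hd yx.
by apply: sU; rewrite /= (seminorm_distC (pP.1 n)).
Qed.

Lemma frechet_dist_complete : separating p -> sequentially_complete p ->
  complete_invariant_metric frechet_dist.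
Proof.
move=> psep pcomplete; split.
- move=> x y; split=> [xy|->]; last first.
    apply/eqP; rewrite eq_le; apply/andP; split.
      apply: frechet_dist_le => k.
      by rewrite subrr (seminorm0 (pP.1 k)) ge_min lexx.
    apply: le_trans (frechet_dist_ge y y 0).
    by rewrite subrr (seminorm0 (pP.1 _)) le_min lexx invr_ge0 ler0n.
  apply/eqP; rewrite -subr_eq0; apply/eqP/psep => k.
  have := frechet_dist_ge x y k; rewrite xy ge_min.
  have k0 : 0 < (k.+1%:R : R)^-1 by rewrite invr_gt0 ltr0n.
  rewrite [X in _ || X]leNgt k0 orbF => pk0.
  by apply/eqP; rewrite eq_le pk0 (seminorm_ge0 (pP.1 k)).
- move=> x y; congr sup; apply: eq_imagel => k _.
  by rewrite (seminorm_distC (pP.1 k)).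
- move=> x y z; apply: frechet_dist_le => k.
  apply: le_trans (lerD (frechet_dist_ge x y k) (frechet_dist_ge y z k)).
  have k0 : 0 < (k.+1%:R : R)^-1 by rewrite invr_gt0 ltr0n.
  move: k.+1%:R^-1 k0 => c c0.
  have := seminorm_dist_triangle (pP.1 k) x y z.
  have := seminorm_ge0 (pP.1 k) (x - y); have := seminorm_ge0 (pP.1 k) (y - z).
  by rewrite !minElt; do 3 case: ltP => ?; lra.
- move=> x y z; congr sup; apply: eq_imagel => k _.
  by rewrite opprD addrACA subrr addr0.
move=> u cu; have [k e e0|l ul] := pcomplete u.
  have [d d0 hd] := frechet_dist_control k e0; have [N hN] := cu _ d0.
  by exists N => m n Nm Nn; apply/hd/hN.
exists l => e e0; have [n [d [d0 hd]]] := frechet_dist_controlled e0.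
by have [N hN] := ul n _ d0; exists N => m /hN /hd.
Qed.

Lemma frechet_seminorm_topology : separating p -> sequentially_complete p ->
  frechet_algebra_topology (seminorm_topology p).
Proof.
move=> psep pcomplete; split; last by exists p.
exists frechet_dist; rewrite frechet_topologyE; split=> //.
exact: frechet_dist_complete.
Qed.

End IncreasingSeminorms.

(** * The trivial extension twisted by a derivation *)

Section Derivation.
Variables (R : realType) (A : comAlgType R[i]) (p : nat -> A -> R).
Hypothesis pP : increasing_submultiplicative_seminorms p.

Definition derivation (D : A -> A) : Prop :=
  linear D /\ forall x y, D (x * y) = x * D y + y * D x.

Lemma derivationB D x y : derivation D -> D (x - y) = D x - D y.
Proof.
case=> linD _; have -> : x - y = (-1) *: y + x by rewrite scaleN1r addrC.
by rewrite linD scaleN1r addrC.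
Qed.

Lemma derivation0 D : derivation D -> D 0 = 0.
Proof. by move=> DD; have := derivationB 0 0 DD; rewrite !subrr. Qed.

(** Submultiplicativity rests on the identity
    D (x y) - (x n + y m) = x (D y - n) + y (D x - m),
    by which the second term of q ((x, m) (y, n)) is at most
    p x p (D y - n) + p y p (D x - m), two of the four terms of the product
    q (x, m) q (y, n). *)
Lemma derivation_seminormP D : derivation D ->
  increasing_submultiplicative_seminorms
    (derivation_seminorm D p : nat -> triv_ext A -> R).
Proof.
move=> DD; have [linD DM] := DD; have [pS pinc] := pP.
have DD' x y : D (x + y) = D x + D y by rewrite -(scale1r x) linD !scale1r.
have DZ c x : D (c *: x) = c *: D x
  by rewrite -[c *: x]addr0 linD (derivation0 DD) addr0.
split=> [k|k x]; last by apply: lerD; exact: pinc.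
have p0 := seminorm_ge0 (pS k); have pD := seminormD (pS k).
have [_ _ pZ pM] := pS k.
split=> [x|[x m] [y n]|c [x m]|[x m] [y n]]; rewrite /derivation_seminorm /=.
- exact: addr_ge0.
- rewrite addrACA; apply: lerD; first exact: pD.
  by rewrite DD' opprD addrACA; exact: pD.
- by rewrite DZ -scalerBr !pZ mulrDr.
have -> : D (x * y) - (x * n + y * m) = x * (D y - n) + y * (D x - m).
  by rewrite DM !mulrBr opprD addrACA.
have := pM x y; have := pM x (D y - n); have := pM y (D x - m).
have := pD (x * (D y - n)) (y * (D x - m)).
have := mulr_ge0 (p0 (D x - m)) (p0 (D y - n)).
nra.
Qed.

Lemma derivation_seminorm_separating D : derivation D ->
  separating p -> separating (derivation_seminorm D p : nat -> triv_ext A -> R).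
Proof.
move=> DD psep [x m] xm0.
have p0 k := seminorm_ge0 (pP.1 k).
have x0 : x = 0.
  by apply: psep => k; have := xm0 k; rewrite /derivation_seminorm /=;
    have := p0 k x; have := p0 k (D x - m); lra.
rewrite x0 in xm0 *; congr pair; apply/eqP; rewrite -oppr_eq0; apply/eqP.
apply: psep => k; have := xm0 k.
rewrite /derivation_seminorm /= (derivation0 DD) sub0r.
by rewrite (seminorm0 (pP.1 k)) add0r.
Qed.

(** If x_n -> x and D x_n - m_n -> w, then (x_n, m_n) -> (x, D x - w), since
    D (x_n - x) - (m_n - (D x - w)) = (D x_n - m_n) - w. *)
Lemma derivation_seminorm_complete D : derivation D ->
  sequentially_complete p ->
  sequentially_complete (derivation_seminorm D p : nat -> triv_ext A -> R).
Proof.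
move=> DD pcomplete u cu; have p0 k := seminorm_ge0 (pP.1 k).
pose z n := D (u n).1 - (u n).2.
have zB m n : D ((u m).1 - (u n).1) - ((u m).2 - (u n).2) = z m - z n.
  by rewrite (derivationB _ _ DD) /z; ring.
have [k e e0|x ux] := pcomplete (fun n => (u n).1).
  have [N hN] := cu k e e0; exists N => m n Nm Nn.
  have := hN m n Nm Nn; rewrite /derivation_seminorm /=.
  by apply: le_lt_trans; rewrite lerDl.
have [k e e0|w zw] := pcomplete z.
  have [N hN] := cu k e e0; exists N => m n Nm Nn.
  have := hN m n Nm Nn; rewrite /derivation_seminorm /= zB.
  by apply: le_lt_trans; rewrite lerDr.
exists (x, D x - w) => k e e0; have e20 : 0 < e / 2 by rewrite divr_gt0.
have [N1 h1] := ux k _ e20; have [N2 h2] := zw k _ e20.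
exists (maxn N1 N2) => n; rewrite geq_max => /andP[/h1 xn /h2 zn].
rewrite /derivation_seminorm /= (derivationB _ _ DD).
have -> : D (u n).1 - D x - ((u n).2 - (D x - w)) = z n - w.
  by rewrite /z; ring.
lra.
Qed.

(** For a linear map this is continuity, tested at 0 only. *)
Definition seminorm_continuous (T : A -> A) : Prop := forall k (e : R), 0 < e ->
  exists n (d : R), 0 < d /\ forall x, p n x < d -> p k (T x) < e.

Lemma derivation_topology_sub D1 D2 : derivation D1 -> derivation D2 ->
  seminorm_continuous D1 -> seminorm_continuous D2 ->
  derivation_topology D1 p `<=` derivation_topology D2 p.
Proof.
move=> DD1 DD2 cD1 cD2 U.
move=> /(seminorm_topologyP (derivation_seminormP DD1)) hU.
apply/(seminorm_topologyP (derivation_seminormP DD2)) => a /hU[k [e [e0 sU]]].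
(* q_{k,D1} is at most p_k x + p_k (D2 x - m) + p_k (D1 x) + p_k (D2 x), and
   each of the four terms gets a quarter of e. *)
have e40 : 0 < e / 4 by rewrite divr_gt0.
have [n1 [d1 [d10 h1]]] := cD1 k _ e40; have [n2 [d2 [d20 h2]]] := cD2 k _ e40.
pose n := maxn k (maxn n1 n2); pose d := Num.min (e / 4) (Num.min d1 d2).
exists n, d; split=> [|b]; first by rewrite !lt_min e40 d10.
rewrite /= => small; apply: sU => /=; move: small.
move: (b - a) => [x m]; rewrite /derivation_seminorm /= => xmd.
have p0 j := seminorm_ge0 (pP.1 j).
have := p0 n x; have := p0 n (D2 x - m).
have := seminorm_dist_triangle (pP.1 k) (D1 x) (D2 x) m.
have := seminormD (pP.1 k) (D1 x) (- D2 x); rewrite (seminormN (pP.1 k)).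
have := seminorm_leq pP x (leq_maxl k (maxn n1 n2)).
have := seminorm_leq pP (D2 x - m) (leq_maxl k (maxn n1 n2)).
have n1n : (n1 <= n)%N by lia.
have n2n : (n2 <= n)%N by lia.
have := seminorm_leq pP x n1n; have := seminorm_leq pP x n2n.
rewrite -/n; move: xmd; rewrite !lt_min => /and3P[xm1 xm2 xm3] ? ? ? ? ? ? ? ?.
have := h1 x; have := h2 x.
move=> /(_ ltac:(lra)) ? /(_ ltac:(lra)) ?; lra.
Qed.

Lemma derivation_topology_eq D1 D2 : derivation D1 -> derivation D2 ->
  seminorm_continuous D1 -> seminorm_continuous D2 ->
  derivation_topology D1 p = derivation_topology D2 p.
Proof. by move=> *; apply/seteqP; split; exact: derivation_topology_sub. Qed.

Lemma derivation_topology_frechet D : derivation D ->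
  separating p -> sequentially_complete p ->
  frechet_algebra_topology (derivation_topology D p).
Proof.
move=> DD psep pcomplete; apply: frechet_seminorm_topology.
- exact: derivation_seminormP.
- exact: derivation_seminorm_separating.
- exact: derivation_seminorm_complete.
Qed.

End Derivation.

(** * Coefficientwise convergence of complex power series *)

Lemma ptws_cvg (I : choiceType) (V : topologicalType) (F : set_system (I -> V))
    (f : I -> V) :
  Filter F -> (forall i, (fun g : I -> V => g i) @ F --> f i) ->
  {ptws, F --> f}.
Proof.
move=> FF Ff; apply/cvg_sup => i; rewrite cvg_image; last first.
  by rewrite eqEsubset; split=> v // _; exists (cst v).
move=> W /Ff /= FW; exists ((@^~ i) @^-1` W) => //.
by rewrite eqEsubset; split => [j [? + <-//]|j Wj]; exists (fun _ => j).
Qed.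

(** A positive complex number is real; this translates the complex-valued radii
    of the topology of R[i] into real ones. *)
Lemma normc_ltE (R : realType) (x e : R[i]) : 0 < e ->
  (`|x| < e) = (Normc.normc x < complex.Re e).
Proof.
by case: e => a b; rewrite ltcE /= => /andP[/eqP -> _]; rewrite ltcR.
Qed.

(** Completeness is inherited from the real and imaginary parts. *)
Lemma complex_complete (R : realType) (u : nat -> R[i]) :
  (forall e : R, 0 < e -> exists N, forall m n, (N <= m)%N -> (N <= n)%N ->
     Normc.normc (u m - u n) < e) ->
  exists l : R[i]^o, u @ \oo --> l.
Proof.
move=> cu.
have cvg_part (f : R[i] -> R) :
    (forall x y, f (x - y) = f x - f y) ->
    (forall x, `|f x| <= Normc.normc x) ->
  exists a : R, f \o u @ \oo --> a.
  move=> fB fle; suff : cvg (f \o u @ \oo) by move=> /cvg_ex.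
  apply/cauchy_cvgP/cauchy_ballP => e e0; near_simpl.
  have [N hN] := cu _ e0.
  exists ([set n | (N <= n)%N], [set n | (N <= n)%N]).
    by split; exists N.
  case=> m n /= [Nm Nn]; rewrite -ball_normE /= -fB.
  exact: le_lt_trans (fle _) (hN _ _ Nm Nn).
have normc_le (x : R[i]) :
    `|complex.Re x| <= Normc.normc x /\ `|complex.Im x| <= Normc.normc x.
  case: x => a b /=; split; rewrite -sqrtr_sqr ler_wsqrtr//.
    by rewrite lerDl sqr_ge0.
  by rewrite lerDr sqr_ge0.
have [||a ua] := cvg_part (@complex.Re R).
- by case=> ? ? [].
- by move=> x; case: (normc_le x).
have [||b ub] := cvg_part (@complex.Im R).
- by case=> ? ? [].
- by move=> x; case: (normc_le x).
exists (Complex a b); apply/(@cvgrPdist_lt _ R[i]^o) => e e0.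
have e1 : 0 < complex.Re e / 2.
  by move: e0; rewrite ltcE /= => /andP[_ e0]; rewrite divr_gt0.
move/cvgrPdist_lt : ua => /(_ _ e1) ua; move/cvgrPdist_lt : ub => /(_ _ e1) ub.
near=> n.
have ea : `|a - complex.Re (u n)| < complex.Re e / 2 by near: n.
have eb : `|b - complex.Im (u n)| < complex.Re e / 2 by near: n.
rewrite normc_ltE// [X in Normc.normc X]complexE.
apply: (le_lt_trans (@le_normcD R _ _)).
have -> : Normc.normc (complex.Re ((a +i* b)%C - u n))%:C%C =
    `|a - complex.Re (u n)|.
  by rewrite /= expr0n addr0 sqrtr_sqr; case: (u n).
have -> : Normc.normc ('i%C * (complex.Im ((a +i* b)%C - u n))%:C%C) =
    `|b - complex.Im (u n)|.
  rewrite Normc.normcM /= !expr0n expr1n /= add0r addr0 sqrtr1 mul1r sqrtr_sqr.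
  by case: (u n).
lra.
Unshelve. all: end_near.
Qed.

(** * The partial derivatives are derivations *)

Section Leibniz.
Variable K : comNzRingType.
Implicit Types (x y : fps K) (i : nat).

Lemma fps_deriv_linear i : linear (@fps_deriv K i).
Proof.
move=> k x y; apply/funext => m.
by rewrite /fps_deriv [LHS]mulrnDl scalerMnr.
Qed.

(** The map (a, b) |-> (a, X_i b) sends the factorizations of m to those
    factorizations a b of X_i m in which X_i divides b; the other ones have
    b_i = 0 and contribute nothing. *)
Lemma fps_mul_derivr i x y m : (x * fps_deriv i y) m =
  \sum_(ab \in [set ab | mmul ab.1 ab.2 = mmul (ucm i) m])
    (x ab.1 * y ab.2) *+ ((ab.2 : cmonom nat) i).
Proof.
pose h (ab : cmonom nat * cmonom nat) := (ab.1, mmul (ucm i) ab.2).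
transitivity (\sum_(ab \in h @` [set ab | mmul ab.1 ab.2 = m])
    (x ab.1 * y ab.2) *+ ((ab.2 : cmonom nat) i)).
  rewrite fsbig_image; last first.
    by move=> [a b] [a' b'] _ _ [-> /mmulI ->].
  apply: eq_fsbigr => -[a b] _ /=.
  by rewrite /fps_deriv cmM cmU eqxx add1n mulrnAr.
apply: fsbig_widen.
  by move=> _ [[a b] /= <- <-] /=; rewrite mulmA (mulmC a) mulmA.
move=> [a b] /= [ab nab].
case: (eqVneq (b i) 0%N) => [->|bi]; first by rewrite mulr0n.
have bE : mmul (ucm i) (divcm b (ucm i)) = b.
  apply/cmonomP => j; rewrite cmM cmU divcmE cmU.
  by case: eqVneq => [<-|_] /=; [rewrite subnKC// lt0n|rewrite subn0].
case: nab; exists (a, divcm b (ucm i)); last by rewrite /h /= bE.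
by apply: (@mmulI (ucm i)); rewrite /= mulmA (mulmC _ a) -mulmA bE.
Qed.

(** In a factorization a b = X_i m the exponents satisfy a_i + b_i = m_i + 1,
    which splits the factor m_i + 1 of the derivative. *)
Lemma fps_deriv_Leibniz i x y :
  fps_deriv i (x * y) = x * fps_deriv i y + y * fps_deriv i x.
Proof.
apply/funext => m; rewrite [RHS]/GRing.add /=.
rewrite !fps_mul_derivr.
transitivity (\sum_(ab \in [set ab | mmul ab.1 ab.2 = mmul (ucm i) m])
    ((x ab.1 * y ab.2) *+ ((ab.2 : cmonom nat) i) +
     (x ab.1 * y ab.2) *+ ((ab.1 : cmonom nat) i))).
  rewrite /fps_deriv -[x * y]/(fps_mul x y) /fps_mul.
  have fF := finite_factorizations (mmul (ucm i) m).
  rewrite !fsbig_finite//= -sumrMnl; apply: eq_big_seq => -[a b].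
  rewrite in_fset_set// => /set_mem /= abm.
  by rewrite -mulrnDr -cmM mulmC abm cmM cmU eqxx add1n.
rewrite fsbig_split/=; last exact: finite_factorizations.
congr +%R.
rewrite (@reindex_fsbig _ _ _ _ _
  (fun ab : cmonom nat * cmonom nat => (ab.2, ab.1))
  [set ab | mmul ab.1 ab.2 = mmul (ucm i) m]) /=.
  by apply: eq_fsbigr => -[a b] _ /=; rewrite mulrC.
split.
- by move=> [a b] /=; rewrite mulmC.
- by move=> [a b] [c d] _ _ [-> ->].
- by move=> [a b] /= ab; exists (b, a); rewrite //= mulmC.
Qed.

End Leibniz.

(** * Continuity of coefficients and of derivatives *)

Lemma coefficient_ball_open (R : realType) m (e : R) : 0 < e ->
  coefficientwise_topology R[i] [set y | Normc.normc (y m) < e].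
Proof.
move=> e0.
have -> : [set y : fps R[i] | Normc.normc (y m) < e] =
    (fun g : {ptws cmonom nat -> R[i]^o} => g m) @^-1`
      ball (0 : R[i]^o) e%:C%C.
  by apply/seteqP; split=> y /=;
     rewrite -ball_normE /= sub0r normrN normc_ltE ?ltcR.
rewrite /coefficientwise_topology /=.
apply: open_comp; last exact: ball_open.
by move=> x _; exact: (@proj_continuous _ (fun=> R[i]^o) m).
Qed.

(** Each coefficient of the derivative is a multiple of one coordinate. *)
Lemma fps_deriv_continuous (R : realType) i U :
  coefficientwise_topology R[i] U ->
  coefficientwise_topology R[i] (@fps_deriv R[i] i @^-1` U).
Proof.
rewrite /coefficientwise_topology /= => oU.
apply: (@open_comp {ptws cmonom nat -> R[i]^o} {ptws cmonom nat -> R[i]^o}) oU.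
move=> x _; pose V := ({ptws cmonom nat -> R[i]^o}).
apply: (@ptws_cvg _ R[i]^o (fps_deriv i @ nbhs (x : V)) (fps_deriv i x)).
move=> m; have := @natmul_continuous _ R[i]^o (m i).+1 (x (mmul (ucm i) m)).
have := @proj_continuous _ (fun=> R[i]^o) (mmul (ucm i) m) x.
exact: cvg_comp.
Qed.

Lemma fps_deriv_derivation (R : realType) i :
  derivation (@fps_deriv R[i] i : fps R[i] -> fps R[i]).
Proof. by split; [exact: fps_deriv_linear|exact: fps_deriv_Leibniz]. Qed.

(** * Seminorms generating coefficientwise convergence *)

Section CoefficientwiseSeminorms.
Variables (R : realType) (p : nat -> fps R[i] -> R).
Hypothesis pP : increasing_submultiplicative_seminorms p.
Hypothesis pE : seminorm_topology p = coefficientwise_topology R[i].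

Lemma coefficientwise_nbhs0 U : coefficientwise_topology R[i] U -> U 0 ->
  exists n (d : R), 0 < d /\ forall x, p n x < d -> U x.
Proof.
rewrite -pE => /(seminorm_topologyP pP) hU /hU[n [d [d0 sU]]].
by exists n, d; split=> // x xd; apply: sU; rewrite /= subr0.
Qed.

Lemma coefficient_controlled m (e : R) : 0 < e ->
  exists n (d : R), 0 < d /\ forall x, p n x < d -> Normc.normc (x m) < e.
Proof.
move=> e0; apply: (coefficientwise_nbhs0 (coefficient_ball_open m e0)).
change (Normc.normc (0 : R[i]) < e).
by rewrite Normc.normc0.
Qed.

Lemma coefficientwise_separating : separating p.
Proof.
move=> x px0; apply/funext => m; apply: Normc.eq0_normc.
apply/eqP; rewrite eq_le; apply/andP; split; last first.
  by case: (x m) => a b; exact: sqrtr_ge0.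
apply/ler_addgt0Pr => e e0; rewrite add0r ltW//.
by have [n [d [d0]]] := coefficient_controlled m e0; apply; rewrite px0.
Qed.

(** A ball of p_k is open for coefficientwise convergence, so it contains the
    tail of any sequence that converges coefficientwise to its centre. *)
Lemma coefficientwise_cvg (u : nat -> fps R[i]) (l : fps R[i]) :
    (forall m, (fun n => u n m : R[i]^o) @ \oo --> (l m : R[i]^o)) ->
  seminorm_cvg p u l.
Proof.
move=> ul k e e0; have uptws : {ptws, u @ \oo --> (l : cmonom nat -> R[i]^o)}.
  exact: ptws_cvg.
have oB := @seminorm_ball_open _ _ _ pP l k e; rewrite pE in oB.
have : nbhs (l : {ptws cmonom nat -> R[i]^o}) [set y | p k (y - l) < e].
  rewrite nbhsE; exists [set y | p k (y - l) < e] => //; split=> //=.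
  by rewrite subrr (seminorm0 (pP.1 k)).
by move=> /uptws [N _ hN]; exists N => n Nn; exact: hN.
Qed.

(** Each coefficient of a Cauchy sequence is Cauchy in R[i]; the limits form a
    series since the coefficients of a series are arbitrary. *)
Lemma coefficientwise_complete : sequentially_complete p.
Proof.
move=> u cu.
have ul m : exists l : R[i]^o, (fun n => u n m) @ \oo --> l.
  apply: complex_complete => e e0.
  have [n [d [d0 hd]]] := coefficient_controlled m e0.
  have [N hN] := cu n d d0; exists N => a b Na Nb; exact: hd (hN _ _ Na Nb).
have [l ulE] := choice ul; exists (l : fps R[i]); exact: coefficientwise_cvg.
Qed.

Lemma fps_deriv_seminorm_continuous i :
  seminorm_continuous p (@fps_deriv R[i] i).
Proof.
move=> k e e0.
apply: (@coefficientwise_nbhs0 (fps_deriv i @^-1` [set y | p k y < e])).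
  apply: fps_deriv_continuous; rewrite -pE.
  by have := @seminorm_ball_open _ _ _ pP 0 k e; under eq_set do rewrite subr0.
by rewrite /= (derivation0 (fps_deriv_derivation R i)) (seminorm0 (pP.1 k)).
Qed.

End CoefficientwiseSeminorms.

Theorem corollary3p3 (R : realType) (p : nat -> fps R[i] -> R) :
  increasing_submultiplicative_seminorms p ->
  seminorm_topology p = coefficientwise_topology R[i] ->
  (forall i : nat, (0 < i)%N ->
     frechet_algebra_topology (derivation_topology (@fps_deriv R[i] i) p)) /\
  (forall i j : nat, (0 < i)%N -> (0 < j)%N ->
     derivation_topology (@fps_deriv R[i] i) p =
     derivation_topology (@fps_deriv R[i] j) p).
Proof.
move=> pP pE; split=> [i _|i j _ _].
  apply: (derivation_topology_frechet pP).
  - exact: fps_deriv_derivation.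
  - exact: coefficientwise_separating pE.
  - exact: coefficientwise_complete pE.
apply: (derivation_topology_eq pP).
- exact: fps_deriv_derivation.
- exact: fps_deriv_derivation.
- exact: fps_deriv_seminorm_continuous.
- exact: fps_deriv_seminorm_continuous.
Qed.
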